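(* Let $N \geq 1$ be an integer, let $a, b \in \mathbb{R}$, and let $f$ be a real-valued function of class $C^{N+1}$ defined on an open neighborhood of $a$ in $\mathbb{R}$, with $f(a) = b$ and $f'(a) \neq 0$. Then there are sufficiently small open intervals $I$ about $a$ (contained in the domain of $f$) and $J$ about $b$ such that for each $y \in J$ there is a unique $x \in I$ with $f(x) = y$. Define $g : J \to I$ by letting $g(y)$ be this unique $x$. Then $f : g(J) \to J$ and $g : J \to g(J)$ are inverses of each other. Moreover, the function $\phi$ defined near $a$ by $$\phi(x) = \frac{x-a}{f(x)-b} \quad (x \neq a), \qquad \phi(a) = \frac{1}{f'(a)},$$ is of class $C^N$, and $$g(y) = a + \sum_{n=1}^{N} \frac{(y-b)^n}{n!}\, D^{n-1}\left[\phi(x)^n\right]_{x=a} + O\left(|y-b|^{N+1}\right) \quad \text{as } y \to b,$$ where $D = d/dx$.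
   Context: Here $D^{n-1}[\phi(x)^n]_{x=a}$ denotes the $(n-1)$-th derivative with respect to $x$ of the $n$-th power $\phi(x)^n$, evaluated at $x=a$ (with $D^0$ the identity). The notation $O(|y-b|^{N+1})$ as $y \to b$ denotes a quantity bounded in absolute value by $C|y-b|^{N+1}$ for some constant $C$ and all $y$ sufficiently close to $b$. An open interval ''about'' a point is an open interval containing that point. *)

(* Defs.v *)
(* Stdlib real numbers with Coquelicot. *)
From Stdlib Require Import Reals Factorial.
From Coquelicot Require Import Coquelicot.
Open Scope R_scope.

(* Partial real functions are represented by total functions [R -> R] together
   with their domain.  As [U] is open, the derivatives of [f] at points of [U]
   do not depend on the values of [f] outside [U]. *)
Definition class_C (k : nat) (f : R -> R) (U : R -> Prop) : Prop :=
  open U /\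
  forall x, U x -> forall j, (j <= k)%nat ->
    ex_derive_n f j x /\ continuous (Derive_n f j) x.

Definition oo_interval (l r : R) : R -> Prop := fun x => l < x < r.

Definition image (g : R -> R) (B : R -> Prop) : R -> Prop :=
  fun x => exists y, B y /\ g y = x.

Definition inverse_maps (f : R -> R) (A : R -> Prop)
    (g : R -> R) (B : R -> Prop) : Prop :=
  (forall x, A x -> B (f x) /\ g (f x) = x) /\
  (forall y, B y -> A (g y) /\ f (g y) = y).

Definition big_O_at (h : R -> R) (m : nat) (b : R) : Prop :=
  exists C : R, locally b (fun y => Rabs (h y) <= C * Rabs (y - b) ^ m).

Definition phi (f : R -> R) (a b : R) : R -> R :=
  fun x => if Req_EM_T x a then 1 / Derive f a else (x - a) / (f x - b).

Definition lagrange_sum (f : R -> R) (a b : R) (N : nat) (y : R) : R :=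
  a + sum_n_m (fun n => (y - b) ^ n / INR (fact n)
                        * Derive_n (fun x => phi f a b x ^ n) (n - 1) a) 1 N.

(* Main.v *)
Require Import Defs.
From Stdlib Require Import Reals Factorial Arith Lra Lia.
From Coquelicot Require Import Coquelicot.
Open Scope R_scope.

(** Write [u = x - a] and [w = f x - b].  By the integral form of the mean value
    theorem [w = u * psi], where [psi x] is the mean of [f'] over the segment from
    [a] to [x]; differentiating under the integral sign shows that [psi] is as
    smooth as [f'] ([Ck_segment_mean]), hence so is [phi = / psi], and
    [w * phi = u].  Existence and uniqueness of [g] come from the mean value and
    intermediate value theorems on an interval where [f'] stays close to [f' a].

    The expansion says that, with [d_i = D^i [phi^(i+1)] (a)], the function
    [E = u - sum_i d_i / (i+1)! * w^(i+1)] is [O(u^(N+1))]; one then substitutes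
    [x = g y] and uses that [|u|] is at most a multiple of [|w|].  As [E] is of
    class [C^(N+1)], it suffices that its derivatives of order at most [N] vanish
    at [a].  This is Lagrange inversion, by residues.  The functionals
    [F |-> D^j [phi^(j+1) F] (a)] are, up to [j!], the residues of [F / w^(j+1)]
    at [u = 0], since [phi = u / w]; the residue of [w' w^(i-j-1)] vanishes unless
    [i = j], in which case it is [1] ([residue_pairing]).  So all these functionals
    kill [E' = 1 - sum_i d_i / i! * w^i w'], the constant [1] contributing exactly
    [d_j].  As [phi a <> 0], they determine the derivatives of [E'] at [a]
    triangularly ([Derive_n_vanish_of_pow_mult]), and these vanish.  No division
    by [u] or [w] is ever performed: everything is phrased through [w * phi = u]
    and its derivative [w' * phi + w * phi' = 1], so only finitely many derivatives
    of [f] are involved. *)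

(** * Functions of class C^k on a set *)

(** Class [C^k] by recursion on the first derivative, given as a witness and not
    as [Derive f]: closure under the ring operations then follows by naming the
    derivative.  On open sets this is [class_C] ([Ck_class_C], [class_C_Ck]). *)
Fixpoint Ck (U : R -> Prop) (k : nat) (f : R -> R) : Prop :=
  match k with
  | O => forall x, U x -> continuous f x
  | S k => exists f', (forall x, U x -> is_derive f x (f' x)) /\ Ck U k f'
  end.

Lemma Ck_continuous U k f : Ck U k f -> forall x, U x -> continuous f x.
Proof.
  destruct k as [|k]; [easy|].
  intros [f' [D _]] x Ux; apply (ex_derive_continuous f); exists (f' x); auto.
Qed.

Lemma Ck_ext U k f g : open U -> (forall x, U x -> f x = g x) -> Ck U k f -> Ck U k g.
Proof.
  intros oU E; destruct k as [|k]; simpl.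
  - intros C x Ux; apply (continuous_ext_loc g f); [|now apply C].
    now apply (locally_open U).
  - intros [f' [D C]]; exists f'; split; [|easy].
    intros x Ux; apply (is_derive_ext_loc f); [|now apply D].
    now apply (locally_open U).
Qed.

Lemma Ck_S U k f : Ck U (S k) f -> Ck U k f.
Proof.
  revert f; induction k as [|k IH]; intros f Cf.
  - exact (Ck_continuous U 1 f Cf).
  - destruct Cf as [f' [D C]]; exists f'; split; [exact D | now apply IH].
Qed.

Lemma Ck_le U j k f : (j <= k)%nat -> Ck U k f -> Ck U j f.
Proof. induction 1; [easy|]; intro C; apply IHle; now apply Ck_S. Qed.

Lemma Ck_subset (U V : R -> Prop) k f : (forall x, V x -> U x) -> Ck U k f -> Ck V k f.
Proof.
  intro VU; revert f; induction k as [|k IH]; intros f; simpl; [now auto|].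
  intros [f' [D C]]; exists f'; auto.
Qed.

Lemma Ck_derivative U k f f' : open U -> (forall x, U x -> is_derive f x (f' x)) ->
  Ck U (S k) f -> Ck U k f'.
Proof.
  intros oU D [f1 [D1 C1]]; apply (Ck_ext U k f1); auto.
  intros x Ux; rewrite <- (is_derive_unique _ _ _ (D x Ux)).
  symmetry; apply is_derive_unique; auto.
Qed.

Lemma Ck_const U k c : Ck U k (fun _ => c).
Proof.
  revert c; induction k as [|k IH]; intro c; simpl.
  - intros; apply continuous_const.
  - exists (fun _ => 0); split; [intros; apply @is_derive_const | apply IH].
Qed.

Lemma Ck_id U k : Ck U k (fun x => x).
Proof.
  destruct k; simpl; [intros; apply continuous_id|].
  exists (fun _ => 1); split; [intros; apply @is_derive_id | apply Ck_const].
Qed.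

Lemma Ck_plus U k f g : Ck U k f -> Ck U k g -> Ck U k (fun x => f x + g x).
Proof.
  revert f g; induction k as [|k IH]; intros f g; simpl.
  - intros Cf Cg x Ux; apply (continuous_plus (V := R_NormedModule) f g); auto.
  - intros [f' [Df Cf]] [g' [Dg Cg]]; exists (fun x => f' x + g' x); split; [|now apply IH].
    intros x Ux; apply (is_derive_plus f g); auto.
Qed.

Lemma is_derive_Rmult (f g : R -> R) x df dg : is_derive f x df -> is_derive g x dg ->
  is_derive (fun y => f y * g y) x (df * g x + f x * dg).
Proof. intros; apply (is_derive_mult f g); auto; intros; apply Rmult_comm. Qed.

Lemma Ck_mult U k f g : Ck U k f -> Ck U k g -> Ck U k (fun x => f x * g x).
Proof.
  revert f g; induction k as [|k IH]; intros f g Cf Cg.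
  - intros x Ux; apply (continuous_mult (K := R_AbsRing) f g); auto.
  - pose proof (Ck_S _ _ _ Cf); pose proof (Ck_S _ _ _ Cg).
    destruct Cf as [f' [Df Cf]], Cg as [g' [Dg Cg]].
    exists (fun x => f' x * g x + f x * g' x); split.
    + intros x Ux; apply is_derive_Rmult; auto.
    + apply Ck_plus; apply IH; auto.
Qed.

Lemma Ck_scal U k c f : Ck U k f -> Ck U k (fun x => c * f x).
Proof. intros; apply Ck_mult; [apply Ck_const | easy]. Qed.

Lemma Ck_minus U k f g : Ck U k f -> Ck U k g -> Ck U k (fun x => f x - g x).
Proof.
  intros Cf Cg; change (Ck U k (fun x => f x + - g x)); apply Ck_plus; [easy|].
  revert g Cg; induction k as [|k IH]; intros g; simpl.
  - intros Cg x Ux; apply (continuous_opp (V := R_NormedModule) g); auto.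
  - intros [g' [Dg Cg]]; exists (fun x => - g' x); split; [|apply IH; auto].
    + intros x Ux; apply (is_derive_opp g); auto.
    + now apply (Ck_S U).
Qed.

Lemma Ck_pow U k f n : Ck U k f -> Ck U k (fun x => f x ^ n).
Proof.
  intro Cf; induction n as [|n IH]; simpl; [apply Ck_const | now apply Ck_mult].
Qed.

Lemma Ck_sum U k (F : nat -> R -> R) n : (forall i, (i <= n)%nat -> Ck U k (F i)) ->
  Ck U k (fun x => sum_f_R0 (fun i => F i x) n).
Proof.
  induction n as [|n IH]; intro C; simpl; [now apply C|].
  apply Ck_plus; [apply IH; intros; apply C; lia | now apply C].
Qed.

Lemma Ck_inv U k f : (forall x, U x -> f x <> 0) -> Ck U k f -> Ck U k (fun x => / f x).
Proof.
  intro nz; induction k as [|k IH]; intro Cf.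
  - intros x Ux; apply continuous_Rinv_comp; auto.
  - pose proof (IH (Ck_S _ _ _ Cf)) as CI.
    destruct Cf as [f' [Df Cf]].
    exists (fun x => - 1 * f' x * (/ f x) ^ 2); split.
    + intros x Ux; replace (- 1 * f' x * (/ f x) ^ 2) with (- f' x / f x ^ 2).
      * apply is_derive_inv; auto.
      * field; auto.
    + apply Ck_mult; [now apply Ck_scal | now apply Ck_pow].
Qed.

(** * Higher derivatives and agreement with [class_C] *)
Lemma Derive_n_shift U f f' n x : open U -> U x ->
  (forall y, U y -> is_derive f y (f' y)) -> Derive_n f (S n) x = Derive_n f' n x.
Proof.
  intros oU Ux D; rewrite <- Nat.add_1_r, <- Derive_n_comp; simpl.
  apply Derive_n_ext_loc, (locally_open U); auto.
  intros; apply is_derive_unique; auto.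
Qed.

Lemma Derive_n_ext_open U f g n x : open U -> U x ->
  (forall y, U y -> f y = g y) -> Derive_n f n x = Derive_n g n x.
Proof. intros; apply Derive_n_ext_loc, (locally_open U); auto. Qed.

Lemma Ck_class_C U k f : open U -> Ck U k f -> class_C k f U.
Proof.
  intros oU C; split; [easy|].
  intros x Ux j; revert f k C; induction j as [|j IH]; intros f k C jk.
  - split; [easy | now apply (Ck_continuous U k)].
  - destruct k as [|k]; [lia|]; destruct C as [f' [D C]].
    destruct (IH f' k C ltac:(lia)) as [Ej Cj].
    assert (L : forall i, locally x (fun y => Derive_n f' i y = Derive_n f (S i) y)).
    { intro i; apply (locally_open U); auto.
      intros y Uy; symmetry; now apply (Derive_n_shift U). }
    split; [|apply (continuous_ext_loc _ (Derive_n f' j)); auto].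
    destruct j as [|j]; simpl.
    + exists (f' x); auto.
    + apply (ex_derive_ext_loc (Derive_n f' j)); [apply L | exact Ej].
Qed.

Lemma class_C_Ck U k f : class_C k f U -> Ck U k f.
Proof.
  intros [oU H]; revert f H; induction k as [|k IH]; intros f H.
  - intros x Ux; apply (H x Ux 0%nat); lia.
  - assert (D : forall x, U x -> is_derive f x (Derive f x)).
    { intros x Ux; apply Derive_correct, (H x Ux 1%nat); lia. }
    exists (Derive f); split; [easy|]; apply IH.
    assert (E : forall i y, Derive_n (Derive f) i y = Derive_n f (S i) y).
    { intros i y; rewrite <- Nat.add_1_r, <- Derive_n_comp; reflexivity. }
    intros x Ux j jk; destruct (H x Ux (S j)) as [H1 H2]; [lia|]; split.
    + destruct j as [|j]; simpl; [easy|].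
      apply (ex_derive_ext (Derive_n f (S j))); [|apply H1].
      intro t; symmetry; apply E.
    + apply (continuous_ext (Derive_n f (S j))); [|exact H2].
      intro; symmetry; apply E.
Qed.

(** * Smoothness of the difference quotient *)

Lemma continuity_2d_pt_line (h : R -> R) k a x t :
  continuous h (a + t * (x - a)) ->
  continuity_2d_pt (fun u v => v ^ k * h (a + v * (u - a))) x t.
Proof.
  intro C; apply continuity_2d_pt_mult.
  - apply (continuity_1d_2d_pt_comp (fun v => v ^ k) (fun _ v => v));
      [reg | apply continuity_2d_pt_id2].
  - apply (continuity_1d_2d_pt_comp h (fun u v => a + v * (u - a))).
    + now apply continuity_pt_filterlim.
    + apply continuity_2d_pt_plus; [apply continuity_2d_pt_const|].
      apply continuity_2d_pt_mult; [apply continuity_2d_pt_id2|].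
      apply continuity_2d_pt_minus; [apply continuity_2d_pt_id1 | apply continuity_2d_pt_const].
Qed.

Lemma continuous_line (h : R -> R) k a x t :
  continuous h (a + t * (x - a)) ->
  continuous (fun v => v ^ k * h (a + v * (x - a))) t.
Proof.
  intro C; apply (continuous_mult (K := R_AbsRing) (fun v => v ^ k)).
  - apply (ex_derive_continuous (fun v : R => v ^ k)); auto_derive; auto.
  - apply (continuous_comp (fun v => a + v * (x - a)) h); [|exact C].
    apply (ex_derive_continuous (fun v : R => a + v * (x - a))); auto_derive; auto.
Qed.

(** For [k = 0] this is the mean of [h] over the segment from [a] to [x]; the weight
    [t ^ k] makes the family stable under differentiation in [x]. *)
Definition segment_mean (a : R) (k : nat) (h : R -> R) (x : R) : R :=
  RInt (fun t => t ^ k * h (a + t * (x - a))) 0 1.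

(** Uniform continuity of [F] near the compact [{x} * [0, 1]] makes the integrands
    uniformly close. *)
Lemma continuous_RInt_param (F : R -> R -> R) x :
  (forall t, 0 <= t <= 1 -> continuity_2d_pt F x t) ->
  locally x (fun y => ex_RInt (F y) 0 1) ->
  continuous (fun y => RInt (F y) 0 1) x.
Proof.
  intros C EI; apply continuity_pt_filterlim.
  intros eps He.
  assert (He2 : 0 < eps / 2) by lra.
  destruct (uniform_continuity_2d_1d' F 0 1 x C (mkposreal _ He2)) as [d Hd].
  destruct EI as [d' Hd'].
  exists (Rmin d d'); split; [apply Rmin_pos; apply cond_pos|].
  intros y [_ Hy]; simpl in Hy |- *; unfold R_dist in *.
  assert (Hy1 : Rabs (y - x) < d) by (eapply Rlt_le_trans; [exact Hy | apply Rmin_l]).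
  assert (Hy2 : Rabs (y - x) < d') by (eapply Rlt_le_trans; [exact Hy | apply Rmin_r]).
  assert (Iy : ex_RInt (F y) 0 1) by (apply Hd'; exact Hy2).
  assert (Ix : ex_RInt (F x) 0 1) by (apply Hd'; apply ball_center).
  replace (RInt (F y) 0 1 - RInt (F x) 0 1) with (RInt (fun t => F y t - F x t) 0 1)
    by apply (RInt_minus (V := R_CompleteNormedModule) (F y) (F x) 0 1 Iy Ix).
  apply Rle_lt_trans with ((1 - 0) * (eps / 2)); [|lra].
  apply abs_RInt_le_const; [lra | now apply (ex_RInt_minus (V := R_NormedModule) (F y) (F x)) |].
  intros t Ht; left; apply Rabs_def2 in Hy1.
  pose proof (cond_pos d).
  apply (Hd t x t y); try lra.
  rewrite Rminus_diag, Rabs_R0; lra.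
Qed.

(** Differentiating under the integral sign turns the mean of [h] with weight [t ^ k]
    into the mean of [h'] with weight [t ^ (k + 1)]; hence the induction is over all
    weights at once. *)
Lemma Ck_segment_mean (U : R -> Prop) a n : open U ->
  (forall x t, U x -> 0 <= t <= 1 -> U (a + t * (x - a))) ->
  forall k h, Ck U n h -> Ck U n (segment_mean a k h).
Proof.
  intros oU star; induction n as [|n IH]; intros k h Ch.
  - intros x Ux; unfold segment_mean.
    apply (continuous_RInt_param (fun x t => t ^ k * h (a + t * (x - a)))).
    + intros t Ht; apply continuity_2d_pt_line; auto.
    + apply (locally_open U); auto.
      intros y Uy; apply @ex_RInt_continuous; intros t Ht.
      rewrite Rmin_left, Rmax_right in Ht by lra.
      apply continuous_line; auto.
  - pose proof (Ck_continuous _ _ _ Ch) as Ch0.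
    destruct Ch as [h' [D C]].
    exists (segment_mean a (S k) h'); split; [|now apply IH].
    pose proof (Ck_continuous _ _ _ C) as C0.
    assert (DL : forall x t, U (a + t * (x - a)) ->
      is_derive (fun u => t ^ k * h (a + t * (u - a))) x (t ^ S k * h' (a + t * (x - a)))).
    { intros x t Ux.
      replace (t ^ S k * h' (a + t * (x - a))) with (t ^ k * (t * h' (a + t * (x - a))))
        by (simpl; ring).
      apply (is_derive_scal (fun u => h (a + t * (u - a)))).
      apply (is_derive_comp h (fun u => a + t * (u - a))); [apply D; auto|].
      auto_derive; [easy | ring]. }
    intros x Ux; unfold segment_mean.
    replace (RInt (fun t => t ^ S k * h' (a + t * (x - a))) 0 1)
      with (RInt (fun t => Derive (fun u => t ^ k * h (a + t * (u - a))) x) 0 1).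
    + apply (is_derive_RInt_param (fun u t => t ^ k * h (a + t * (u - a)))).
      * apply (locally_open U); auto.
        intros y Uy t Ht; rewrite Rmin_left, Rmax_right in Ht by lra.
        eexists; apply DL; auto.
      * intros t Ht; rewrite Rmin_left, Rmax_right in Ht by lra.
        apply continuity_2d_pt_ext_loc with (fun u v => v ^ S k * h' (a + v * (u - a)));
          [|apply continuity_2d_pt_line; auto].
        (* [v] may leave [0, 1] here, so [star] does not apply to [a + v * (u - a)];
           openness of [U] does. *)
        destruct (oU _ (star x t Ux Ht)) as [e He].
        destruct (continuity_2d_pt_line (fun z => z) 0 a x t (continuous_id _) e) as [d Hd].
        exists d; intros u v Hu Hv; symmetry; apply is_derive_unique, DL, He.
        generalize (Hd u v Hu Hv); simpl; rewrite !Rmult_1_l; easy.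
      * apply (locally_open U); auto.
        intros y Uy; apply @ex_RInt_continuous; intros t Ht.
        rewrite Rmin_left, Rmax_right in Ht by lra.
        apply continuous_line; auto.
    + apply RInt_ext; intros t Ht; rewrite Rmin_left, Rmax_right in Ht by lra.
      apply is_derive_unique, DL, star; [easy | lra].
Qed.

(** The fundamental theorem of calculus for [t |-> f (a + t * (x - a))]. *)
Lemma segment_mean_slope (U : R -> Prop) a f f' :
  (forall x t, U x -> 0 <= t <= 1 -> U (a + t * (x - a))) ->
  (forall x, U x -> is_derive f x (f' x)) -> (forall x, U x -> continuous f' x) ->
  forall x, U x -> f x - f a = (x - a) * segment_mean a 0 f' x.
Proof.
  intros star D C x Ux.
  assert (I : is_RInt (fun t => (x - a) * f' (a + t * (x - a))) 0 1
                (f (a + 1 * (x - a)) - f (a + 0 * (x - a)))).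
  { apply (is_RInt_derive (V := R_CompleteNormedModule) (fun t => f (a + t * (x - a))));
      intros t Ht; rewrite Rmin_left, Rmax_right in Ht by lra.
    - apply (is_derive_comp f (fun t => a + t * (x - a))); [apply D; auto|].
      auto_derive; [easy | ring].
    - apply (continuous_scal_r (V := R_NormedModule) (x - a)).
      apply (continuous_comp (fun t => a + t * (x - a)) f'); [|apply C; auto].
      apply (ex_derive_continuous (fun v : R => a + v * (x - a))); auto_derive; auto. }
  apply (is_RInt_unique (V := R_CompleteNormedModule)) in I.
  replace (f x - f a) with (f (a + 1 * (x - a)) - f (a + 0 * (x - a)))
    by (do 2 f_equal; [f_equal; ring | ]; f_equal; ring).
  rewrite <- I; unfold segment_mean.
  rewrite (RInt_ext (fun t => t ^ 0 * f' (a + t * (x - a))) (fun t => f' (a + t * (x - a))))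
    by (intros; simpl; ring).
  apply (RInt_scal (V := R_CompleteNormedModule)), @ex_RInt_continuous; intros t Ht.
  rewrite Rmin_left, Rmax_right in Ht by lra.
  apply (continuous_comp (fun t => a + t * (x - a)) f'); [|apply C; auto].
  apply (ex_derive_continuous (fun v : R => a + v * (x - a))); auto_derive; auto.
Qed.

Lemma segment_mean_center a h : segment_mean a 0 h a = h a.
Proof.
  unfold segment_mean; rewrite (RInt_ext _ (fun _ => h a)).
  - rewrite RInt_const; unfold scal; simpl; unfold mult; simpl; ring.
  - intros t _; simpl; rewrite Rmult_1_l; f_equal; ring.
Qed.

(** * Derivatives at a point and orders of vanishing *)

Section Jets.
Variables (U : R -> Prop) (a : R).
Hypotheses (oU : open U) (Ua : U a).

Lemma Derive_n_Ck_plus n f g : Ck U n f -> Ck U n g ->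
  Derive_n (fun x => f x + g x) n a = Derive_n f n a + Derive_n g n a.
Proof.
  revert f g; induction n as [|n IH]; intros f g Cf Cg; [easy|].
  destruct Cf as [f' [Df Cf]], Cg as [g' [Dg Cg]].
  rewrite (Derive_n_shift U f f'), (Derive_n_shift U g g') by auto.
  rewrite <- IH by auto; apply (Derive_n_shift U); auto.
  intros; apply (is_derive_plus f g); auto.
Qed.

Lemma Derive_n_Ck_minus n f g : Ck U n f -> Ck U n g ->
  Derive_n (fun x => f x - g x) n a = Derive_n f n a - Derive_n g n a.
Proof.
  intros Cf Cg.
  transitivity (Derive_n (fun x => f x + -1 * g x) n a).
  { apply Derive_n_ext; intro; ring. }
  rewrite Derive_n_Ck_plus, Derive_n_scal_l by auto using Ck_scal; ring.
Qed.

Lemma Derive_n_Ck_sum n (F : nat -> R -> R) m : (forall i, (i <= m)%nat -> Ck U n (F i)) ->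
  Derive_n (fun x => sum_f_R0 (fun i => F i x) m) n a
  = sum_f_R0 (fun i => Derive_n (F i) n a) m.
Proof.
  induction m as [|m IH]; intro C; simpl; [easy|].
  rewrite Derive_n_Ck_plus, IH; auto.
  apply Ck_sum; auto.
Qed.

(** The lowest-order term of a product: in Leibniz' formula only the term without
    derivatives of [h] survives. *)
Lemma Derive_n_mult_vanishing n h F : Ck U n h -> Ck U n F ->
  (forall i, (i < n)%nat -> Derive_n F i a = 0) ->
  Derive_n (fun x => h x * F x) n a = h a * Derive_n F n a.
Proof.
  revert h F; induction n as [|n IH]; intros h F Ch CF H; [easy|].
  pose proof (Ck_S _ _ _ Ch); pose proof (Ck_S _ _ _ CF).
  destruct Ch as [h' [Dh Ch]], CF as [F' [DF CF]].
  rewrite (Derive_n_shift U _ (fun x => h' x * F x + h x * F' x))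
    by (auto; intros; apply is_derive_Rmult; auto).
  rewrite Derive_n_Ck_plus by (apply Ck_mult; auto).
  rewrite IH, H by auto.
  rewrite IH; auto.
  - rewrite <- (Derive_n_shift U F F') by auto; ring.
  - intros i Hi; rewrite <- (Derive_n_shift U F F') by auto; apply H; lia.
Qed.

Lemma Ck_sub_center n : Ck U n (fun x => x - a).
Proof. apply Ck_minus; [apply Ck_id | apply Ck_const]. Qed.

Lemma Derive_n_mult_sub n G : Ck U (S n) G ->
  Derive_n (fun x => (x - a) * G x) (S n) a = INR (S n) * Derive_n G n a.
Proof.
  revert G; induction n as [|n IH]; intros G CG;
    pose proof (Ck_S _ _ _ CG); destruct CG as [G' [DG CG]];
    rewrite (Derive_n_shift U _ (fun x => 1 * G x + (x - a) * G' x))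
      by (auto; intros; apply (is_derive_Rmult (fun x => x - a)); auto; auto_derive; auto; ring).
  - simpl; ring.
  - rewrite Derive_n_Ck_plus by auto using Ck_mult, Ck_const, Ck_sub_center.
    rewrite Derive_n_scal_l, IH, (S_INR (S n)) by auto.
    rewrite (Derive_n_shift U G G') by auto; ring.
Qed.

Lemma Derive_n_mult_sub_pow p q G : Ck U (p + q) G ->
  Derive_n (fun x => (x - a) ^ p * G x) (p + q) a
  = INR (fact (p + q)) / INR (fact q) * Derive_n G q a.
Proof.
  intro CG; induction p as [|p IH].
  - simpl; rewrite (Derive_n_ext _ G) by (intro; ring).
    field; apply INR_fact_neq_0.
  - transitivity (Derive_n (fun x => (x - a) * ((x - a) ^ p * G x)) (S (p + q)) a).
    { apply Derive_n_ext; intro; simpl; ring. }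
    rewrite Derive_n_mult_sub, IH.
    + change (S p + q)%nat with (S (p + q)); rewrite fact_simpl, mult_INR.
      field; apply INR_fact_neq_0.
    + now apply Ck_S.
    + apply Ck_mult; [apply Ck_pow, Ck_sub_center | easy].
Qed.

Lemma Derive_n_mult_sub_pow_lt p n G : (n < p)%nat -> Ck U n G ->
  Derive_n (fun x => (x - a) ^ p * G x) n a = 0.
Proof.
  revert p; induction n as [|n IH]; intros p np CG;
    (destruct p as [|p]; [lia|]).
  - simpl; ring.
  - transitivity (Derive_n (fun x => (x - a) * ((x - a) ^ p * G x)) (S n) a).
    { apply Derive_n_ext; intro; simpl; ring. }
    rewrite Derive_n_mult_sub, IH; [ring | lia | now apply Ck_S |].
    apply Ck_mult; [apply Ck_pow, Ck_sub_center | easy].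
Qed.

(** The functionals [F |-> D^j [h^(j+1) F] (a)] form a triangular system in the
    derivatives of [F] at [a], with diagonal entries [h a ^ (j+1)]. *)
Lemma Derive_n_vanish_of_pow_mult n F h : h a <> 0 -> Ck U n F -> Ck U n h ->
  (forall j, (j <= n)%nat -> Derive_n (fun x => h x ^ S j * F x) j a = 0) ->
  forall j, (j <= n)%nat -> Derive_n F j a = 0.
Proof.
  intros ha CF Ch H j; induction j as [j IH] using lt_wf_ind; intro jn.
  pose proof (H j jn) as Hj.
  rewrite Derive_n_mult_vanishing in Hj.
  - apply Rmult_integral in Hj; destruct Hj as [Hj|]; [|easy].
    now apply pow_nonzero in Hj.
  - apply Ck_pow; now apply (Ck_le U j n).
  - now apply (Ck_le U j n).
  - intros i ij; apply IH; lia.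
Qed.

(** A two-sided substitute for Taylor's formula, with only a continuous top
    derivative: a bound for [F'] gives one for [F] by the mean value theorem. *)
Lemma Ck_vanishing_bound n F : Ck U n F ->
  (forall i, (i < n)%nat -> Derive_n F i a = 0) ->
  exists (C : R) (d : posreal), 0 <= C /\
    forall x, Rabs (x - a) < d -> Rabs (F x) <= C * Rabs (x - a) ^ n.
Proof.
  revert F; induction n as [|n IH]; intros F CF H.
  - destruct (proj1 (filterlim_locally _ _) (CF a Ua) (mkposreal 1 Rlt_0_1)) as [d Hd].
    exists (Rabs (F a) + 1), d; split; [pose proof (Rabs_pos (F a)); lra|].
    intros x Hx; rewrite Rmult_1_r.
    assert (Hb : Rabs (F x - F a) < 1) by (apply (Hd x Hx)).
    pose proof (Rabs_triang (F x - F a) (F a)) as T.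
    replace (F x - F a + F a) with (F x) in T by ring; lra.
  - pose proof (H 0%nat ltac:(lia)) as Fa; simpl in Fa.
    destruct CF as [F' [DF CF]].
    destruct (IH F' CF) as [C [d [HC Hd]]].
    { intros i Hi; rewrite <- (Derive_n_shift U F F') by auto; apply H; lia. }
    destruct (oU a Ua) as [e He].
    exists C, (mkposreal _ (Rmin_pos d e (cond_pos d) (cond_pos e))); split; [easy|]; simpl.
    intros x Hx.
    assert (nearer : forall c, Rmin a x <= c <= Rmax a x -> Rabs (c - a) <= Rabs (x - a)).
    { intros c [Hc1 Hc2].
      unfold Rmin, Rmax in *; destruct (Rle_dec a x);
        [rewrite !Rabs_pos_eq | rewrite !Rabs_left1]; lra. }
    assert (Se : forall c, Rmin a x <= c <= Rmax a x -> U c).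
    { intros c Hc; apply He; apply nearer in Hc.
      apply Rle_lt_trans with (1 := Hc), Rlt_le_trans with (1 := Hx), Rmin_r. }
    destruct (MVT_gen F a x F') as [c [Hc E]].
    + intros c Hc; apply DF, Se; lra.
    + intros c Hc; apply continuity_pt_filterlim, (ex_derive_continuous F).
      exists (F' c); apply DF, Se; lra.
    + rewrite Fa, Rminus_0_r in E; rewrite E, Rabs_mult.
      apply nearer in Hc.
      assert (B : Rabs (F' c) <= C * Rabs (c - a) ^ n).
      { apply Hd, Rle_lt_trans with (1 := Hc), Rlt_le_trans with (1 := Hx), Rmin_l. }
      replace (C * (Rabs (x - a) * Rabs (x - a) ^ n)) with (C * Rabs (x - a) ^ n * Rabs (x - a))
        by ring.
      apply Rmult_le_compat_r; [apply Rabs_pos|].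
      apply Rle_trans with (1 := B), Rmult_le_compat_l; [easy|].
      apply pow_incr; split; [apply Rabs_pos | easy].
Qed.

(** * Lagrange inversion for jets *)

(** [w] is the function to be inverted, [p] plays the role of [(x - a) / w]. *)
Section Lagrange.
Variables (M : nat) (w w' p : R -> R).
Hypotheses (Dw : forall x, U x -> is_derive w x (w' x)) (Cw' : Ck U (S M) w')
  (Cp : Ck U (S M) p) (wp : forall x, U x -> w x * p x = x - a) (wa : w a = 0).

Lemma Ck_w_top : Ck U (S (S M)) w.
Proof. exists w'; auto. Qed.

Lemma inverse_slope_derivative : exists p', (forall x, U x -> is_derive p x (p' x)) /\
  Ck U M p' /\ forall x, U x -> w' x * p x + w x * p' x = 1.
Proof.
  destruct Cp as [p' [Dp Cp']]; exists p'; split; [|split]; auto.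
  intros x Ux; rewrite <- (is_derive_unique _ _ _ (is_derive_Rmult w p x _ _ (Dw x Ux) (Dp x Ux))).
  apply is_derive_unique, (is_derive_ext_loc (fun x => x - a)).
  - apply (locally_open U); auto; intros; symmetry; auto.
  - auto_derive; auto; ring.
Qed.

(** Up to the factor [j!], the left-hand side is the residue at [a] of
    [w^(i-j-1) * w'].  This is [1] for the logarithmic derivative ([i = j]) and [0] for
    the derivative of a Laurent series in the other cases: for [i > j] the function
    is regular, and for [i < j], with [r = j - i] and [H = p^r], that is with
    [H = (x - a)^r * w^(-r)], the claim reduces to the vanishing of the [r]-th
    derivative of [H - (x - a) * H' / r] at [a]. *)
Lemma residue_pairing i j : (i <= M)%nat -> (j <= M)%nat ->
  Derive_n (fun x => p x ^ S j * (w x ^ i * w' x)) j a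
  = if Nat.eq_dec i j then INR (fact j) else 0.
Proof.
  intros iM jM.
  destruct inverse_slope_derivative as [p' [Dp [Cp' pr]]].
  assert (CM : forall k F, (k <= S M)%nat -> Ck U (S M) F -> Ck U k F)
    by (intros; now apply (Ck_le U k (S M))).
  assert (Cw : Ck U (S M) w) by apply Ck_S, Ck_w_top.
  destruct (Nat.eq_dec i j) as [<-|ij]; [|destruct (Nat.lt_ge_cases j i) as [ji|ji]].
  - transitivity (Derive_n (fun x => (x - a) ^ i * (p x * w' x)) (i + 0) a).
    { rewrite Nat.add_0_r; apply (Derive_n_ext_open U); auto.
      intros y Uy; rewrite <- (wp y Uy), Rpow_mult_distr; simpl; ring. }
    rewrite Derive_n_mult_sub_pow by (apply CM; [lia | now apply Ck_mult]).
    specialize (pr a Ua); rewrite wa in pr; simpl; rewrite Nat.add_0_r.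
    replace (p a * w' a) with 1 by (rewrite <- pr; ring); field.
  - transitivity (Derive_n (fun x => (x - a) ^ S j * (w x ^ (i - S j) * w' x)) j a).
    { apply (Derive_n_ext_open U); auto.
      intros y Uy; rewrite <- (wp y Uy), Rpow_mult_distr.
      replace i with (S j + (i - S j))%nat at 1 by lia; rewrite pow_add; ring. }
    apply Derive_n_mult_sub_pow_lt; [lia|].
    apply CM; [lia|]; apply Ck_mult; [apply Ck_pow|]; easy.
  - destruct (j - i)%nat as [|q] eqn:Eq; [lia|].
    assert (j = i + S q)%nat by lia; subst j; clear ij ji Eq.
    (* [S q] is the [r] above and [P'] the derivative of [H]. *)
    set (P' := fun x => INR (S q) * p' x * p x ^ q).
    assert (CP' : Ck U M P').
    { apply Ck_mult; [now apply Ck_scal | apply Ck_pow; now apply Ck_S]. }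
    assert (DP : forall x, U x -> is_derive (fun x => p x ^ S q) x (P' x)).
    { intros x Ux; apply (is_derive_pow p (S q)); auto. }
    assert (nz : INR (S q) <> 0) by (apply not_0_INR; lia).
    transitivity (Derive_n (fun x => (x - a) ^ i *
      (p x ^ S q - / INR (S q) * ((x - a) * P' x))) (i + S q) a).
    { apply (Derive_n_ext_open U); auto.
      intros y Uy; rewrite <- (wp y Uy), Rpow_mult_distr.
      replace (S (i + S q)) with (i + S (S q))%nat by lia; rewrite pow_add.
      transitivity (w y ^ i * p y ^ i * (p y ^ q * p y) * (w' y * p y)); [simpl; ring|].
      replace (w' y * p y) with (1 - w y * p' y) by (rewrite <- (pr y Uy); ring).
      unfold P'; change (p y ^ S q) with (p y * p y ^ q); field; easy. }
    assert (CX : Ck U M (fun x => (x - a) * P' x))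
      by (apply Ck_mult; [apply Ck_sub_center | easy]).
    rewrite Derive_n_mult_sub_pow, Derive_n_Ck_minus, Derive_n_scal_l, Derive_n_mult_sub.
    + rewrite (Derive_n_shift U _ P') by auto.
      field; split; [easy | apply INR_fact_neq_0].
    + apply (Ck_le U _ M); [lia | easy].
    + apply CM; [lia|]; now apply Ck_pow.
    + apply (Ck_le U _ M); [lia | now apply Ck_scal].
    + apply (Ck_le U _ M); [lia|].
      apply Ck_minus; [apply Ck_pow; now apply Ck_S | now apply Ck_scal].
Qed.

(** The error of the inversion, read in the variable [x] and not in [y = w x], so
    that no regularity of the inverse function is needed. *)
Definition lagrange_remainder x :=
  x - a - sum_f_R0 (fun i =>
    Derive_n (fun z => p z ^ S i) i a / INR (fact (S i)) * w x ^ S i) M.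

(** Pairing the derivative of the remainder with [p^(j+1)] leaves
    [d_j - d_j / j! * j! = 0]. *)
Lemma lagrange_remainder_jet :
  Ck U (S (S M)) lagrange_remainder /\
  forall i, (i < S (S M))%nat -> Derive_n lagrange_remainder i a = 0.
Proof.
  set (d := fun i => Derive_n (fun z => p z ^ S i) i a).
  set (E' := fun x => 1 - sum_f_R0 (fun i => d i / INR (fact i) * (w x ^ i * w' x)) M).
  assert (CT : forall i, Ck U (S M) (fun x => d i / INR (fact i) * (w x ^ i * w' x))).
  { intro i; apply Ck_scal, Ck_mult; [apply Ck_pow, Ck_S, Ck_w_top | easy]. }
  assert (CE' : Ck U (S M) E').
  { apply Ck_minus; [apply Ck_const|].
    apply (Ck_sum U (S M) (fun i x => d i / INR (fact i) * (w x ^ i * w' x))); auto. }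
  assert (DE : forall x, U x -> is_derive lagrange_remainder x (E' x)).
  { intros x Ux; apply (is_derive_minus (fun x => x - a)).
    - auto_derive; auto; ring.
    - fold d; rewrite <- sum_n_Reals.
      apply (is_derive_ext (fun y => sum_n (fun i => d i / INR (fact (S i)) * w y ^ S i) M)).
      { intro; apply sum_n_Reals. }
      apply (is_derive_sum_n (fun i y => d i / INR (fact (S i)) * w y ^ S i)).
      intros i _.
      replace (d i / INR (fact i) * (w x ^ i * w' x))
        with (d i / INR (fact (S i)) * (INR (S i) * w' x * w x ^ i)).
      + apply (is_derive_scal (fun y => w y ^ S i)), (is_derive_pow w (S i)); auto.
      + rewrite fact_simpl, mult_INR; field; split; [apply INR_fact_neq_0 | apply not_0_INR; lia]. }
  split; [exists E'; auto|].
  intros [|i] Hi.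
  - simpl; unfold lagrange_remainder; rewrite wa.
    rewrite (sum_eq _ (fun _ => 0)) by (intros; simpl; ring).
    rewrite sum_cte; ring.
  - rewrite (Derive_n_shift U _ E') by auto.
    apply (Derive_n_vanish_of_pow_mult M E' p); [| now apply Ck_S | now apply Ck_S | | lia].
    { intro pa; destruct inverse_slope_derivative as [p' [_ [_ pr]]].
      specialize (pr a Ua); rewrite wa, pa in pr; lra. }
    clear i Hi; intros j Hj.
    transitivity (Derive_n (fun x => p x ^ S j - sum_f_R0 (fun i =>
      d i / INR (fact i) * (p x ^ S j * (w x ^ i * w' x))) M) j a).
    { apply Derive_n_ext; intro x; unfold E'.
      rewrite Rmult_minus_distr_l, Rmult_1_r, scal_sum; f_equal.
      apply sum_eq; intros; ring. }
    assert (CT' : forall i, Ck U j (fun x => d i / INR (fact i) * (p x ^ S j * (w x ^ i * w' x)))).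
    { intro i; apply (Ck_le U j (S M)); [lia|].
      apply Ck_scal, Ck_mult; [now apply Ck_pow|].
      apply Ck_mult; [apply Ck_pow, Ck_S, Ck_w_top | easy]. }
    rewrite Derive_n_Ck_minus.
    + rewrite (Derive_n_Ck_sum j (fun i x => d i / INR (fact i) * (p x ^ S j * (w x ^ i * w' x))))
        by auto.
      rewrite (sum_eq _ (fun i => if Nat.eq_dec i j then d j else 0)).
      * fold (d j).
        assert (pick : forall m, sum_f_R0 (fun i => if Nat.eq_dec i j then d j else 0) m
                  = if le_dec j m then d j else 0).
        { induction m as [|m IH]; cbn [sum_f_R0].
          - destruct (Nat.eq_dec 0 j), (le_dec j 0); (lra || (exfalso; lia)).
          - rewrite IH; destruct (le_dec j m), (Nat.eq_dec (S m) j), (le_dec j (S m));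
              (lra || (exfalso; lia)). }
        rewrite pick; destruct (le_dec j M); [ring | lia].
      * intros i Hi; rewrite Derive_n_scal_l, residue_pairing by auto.
        destruct (Nat.eq_dec i j) as [->|]; [field; apply INR_fact_neq_0 | ring].
    + apply Ck_pow; apply (Ck_le U j (S M)); [lia | easy].
    + apply (Ck_sum U j (fun i x => d i / INR (fact i) * (p x ^ S j * (w x ^ i * w' x)))); auto.
Qed.

End Lagrange.
End Jets.

(** * Local inversion *)

Section Local_inverse.
Variables (f : R -> R) (a c r : R).
Hypotheses (c0 : c <> 0)
  (Df : forall x, Rabs (x - a) < r -> is_derive f x (Derive f x))
  (near_c : forall x, Rabs (x - a) < r -> Rabs (Derive f x - c) < Rabs c / 2).

Lemma secant_slope_near x z : Rabs (x - a) < r -> Rabs (z - a) < r ->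
  exists m, Rabs (m - c) < Rabs c / 2 /\ f x - f z = m * (x - z).
Proof.
  intros Hx Hz; apply Rabs_def2 in Hx, Hz.
  assert (near : forall y, Rmin z x <= y <= Rmax z x -> Rabs (y - a) < r).
  { intros y [Hy1 Hy2]; apply Rabs_def1;
      unfold Rmin, Rmax in *; destruct (Rle_dec z x); lra. }
  destruct (MVT_gen f z x (Derive f)) as [y [Hy E]].
  - intros y Hy; apply Df, near; lra.
  - intros y Hy; apply continuity_pt_filterlim, (ex_derive_continuous f).
    exists (Derive f y); auto.
  - exists (Derive f y); auto.
Qed.

Lemma Rabs_diff_lower_bound x z : Rabs (x - a) < r -> Rabs (z - a) < r ->
  Rabs c / 2 * Rabs (x - z) <= Rabs (f x - f z).
Proof.
  intros Hx Hz; destruct (secant_slope_near x z Hx Hz) as [m [Hm ->]].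
  rewrite Rabs_mult; apply Rmult_le_compat_r; [apply Rabs_pos|].
  pose proof (Rabs_triang_inv c (c - m)) as T.
  replace (c - (c - m)) with m in T by ring.
  rewrite Rabs_minus_sym in Hm; lra.
Qed.

(** The image of an interval of radius [d] covers radius [|c| / 2 * d], because secant
    slopes have absolute value at least [|c| / 2].  Dividing by [c] makes them positive
    whatever the sign of [c]. *)
Lemma preimage_exists d y : 0 < d -> d < r -> Rabs (y - f a) < Rabs c / 2 * d ->
  exists x, a - d < x < a + d /\ f x = y.
Proof.
  intros d0 dr Hy.
  assert (ca : 0 < Rabs c) by now apply Rabs_pos_lt.
  assert (V : forall x, a - d <= x <= a + d -> Rabs (x - a) < r)
    by (intros; apply Rabs_def1; lra).
  set (F := fun x => (f x - y) / c).
  assert (B : Rabs ((f a - y) / c) < d / 2).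
  { unfold Rdiv; rewrite Rabs_mult, Rabs_inv, Rabs_minus_sym.
    apply (Rmult_lt_reg_r (Rabs c)); [easy|].
    rewrite Rmult_assoc, Rinv_l by lra; lra. }
  apply Rabs_def2 in B.
  assert (Q : forall x, Rabs (x - a) < r -> exists s,
    1 / 2 < s /\ F x = s * (x - a) + (f a - y) / c).
  { intros x Hx; destruct (secant_slope_near x a Hx) as [m [Hm E]].
    { rewrite Rminus_diag, Rabs_R0; lra. }
    exists (m / c); split.
    - replace (m / c) with (1 + (m - c) / c) by (field; easy).
      assert (Rabs ((m - c) / c) < 1 / 2) as K.
      { unfold Rdiv; rewrite Rabs_mult, Rabs_inv.
        apply (Rmult_lt_reg_r (Rabs c)); [easy|].
        rewrite Rmult_assoc, Rinv_l by lra; lra. }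
      apply Rabs_def2 in K; lra.
    - unfold F; replace (f x) with (f a + m * (x - a)) by lra; field; easy. }
  destruct (Ranalysis5.IVT_interv F (a - d) (a + d)) as [x [Hx Fx]].
  - intros x Hx; apply continuity_pt_filterlim, (ex_derive_continuous F).
    assert (Hx' : Rabs (x - a) < r) by (apply V; lra).
    unfold F; auto_derive; exists (Derive f x); now apply Df.
  - lra.
  - destruct (Q (a - d)) as [s [Hs ->]]; [apply V; lra | nra].
  - destruct (Q (a + d)) as [s [Hs ->]]; [apply V; lra | nra].
  - assert (fx : f x = y).
    { unfold F in Fx; apply (Rmult_eq_compat_r c) in Fx.
      unfold Rdiv in Fx; rewrite Rmult_assoc, Rinv_l, Rmult_0_l, Rmult_1_r in Fx by easy; lra. }
    exists x; split; [|easy].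
    assert (x <> a - d).
    { intros ->; destruct (Q (a - d)) as [s [Hs K]]; [apply V; lra|]; nra. }
    assert (x <> a + d).
    { intros ->; destruct (Q (a + d)) as [s [Hs K]]; [apply V; lra|]; nra. }
    lra.
Qed.
End Local_inverse.

(** * The expansion of the inverse function *)

Lemma phi_inverse_slope f a b x s : Derive f a <> 0 -> s <> 0 ->
  (x = a -> s = Derive f a) -> f x - b = (x - a) * s -> phi f a b x = / s.
Proof.
  intros fa s0 sa E; unfold phi; destruct (Req_EM_T x a) as [->|xa].
  - rewrite sa by easy; field; easy.
  - rewrite E; field; split; [easy | lra].
Qed.

Lemma lagrange_sum_remainder f a b M x :
  x - lagrange_sum f a b (S M) (f x)
  = lagrange_remainder a M (fun z => f z - b) (phi f a b) x.
Proof.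
  unfold lagrange_sum, lagrange_remainder.
  rewrite <- sum_n_m_S; fold (sum_n (fun n => (f x - b) ^ S n / INR (fact (S n)) *
    Derive_n (fun z => phi f a b z ^ S n) (S n - 1) a) M).
  rewrite sum_n_Reals; unfold Rminus at 1; rewrite Ropp_plus_distr, <- Rplus_assoc.
  unfold Rminus at 2; f_equal; f_equal; apply sum_eq; intros i _.
  rewrite Nat.sub_1_r; unfold Rdiv; simpl (Nat.pred _); ring.
Qed.

Theorem theorem2 (N : nat) (hN : (1 <= N)%nat) (a b : R)
    (f : R -> R) (U : R -> Prop) (hUa : U a) (hf : class_C (N + 1) f U)
    (hfa : f a = b) (hf'a : Derive f a <> 0) :
  (exists l r p q : R,
     let I := oo_interval l r in
     let J := oo_interval p q in
     I a /\ (forall x, I x -> U x) /\ J b /\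
     (forall y, J y -> exists! x, I x /\ f x = y) /\
     (forall g : R -> R, (forall y, J y -> I (g y) /\ f (g y) = y) ->
        inverse_maps f (image g J) g J /\
        big_O_at (fun y => g y - lagrange_sum f a b N y) (N + 1) b)) /\
  (exists V : R -> Prop,
     V a /\ (forall x, V x -> U x) /\
     (forall x, V x -> x <> a -> f x - b <> 0) /\
     class_C N (phi f a b) V).
Proof.
  pose proof (proj1 hf) as oU.
  apply class_C_Ck in hf; rewrite Nat.add_1_r in *.
  assert (Df : forall x, U x -> is_derive f x (Derive f x)).
  { destruct hf as [f' [D _]]; intros x Ux; apply Derive_correct; exists (f' x); auto. }
  assert (Cf' : Ck U N (Derive f)) by now apply (Ck_derivative U N f).
  set (c := Derive f a) in *.
  assert (ca : 0 < Rabs c) by now apply Rabs_pos_lt.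
  assert (Hr : exists r, 0 < r /\ forall x, Rabs (x - a) < r ->
    U x /\ Rabs (Derive f x - c) < Rabs c / 2).
  { destruct (oU a hUa) as [e He].
    assert (c2 : 0 < Rabs c / 2) by lra.
    destruct (proj1 (filterlim_locally _ _) (Ck_continuous U N _ Cf' a hUa) (mkposreal _ c2))
      as [d Hd].
    exists (Rmin e d); split; [apply Rmin_pos; apply cond_pos|].
    intros x Hx; split.
    - apply He, (Rlt_le_trans _ _ _ Hx), Rmin_l.
    - apply (Hd x), (Rlt_le_trans _ _ _ Hx), Rmin_r. }
  destruct Hr as [r [r0 Hr]].
  set (V := fun x => Rabs (x - a) < r).
  assert (Va : V a) by (unfold V; rewrite Rminus_diag, Rabs_R0; easy).
  assert (VU : forall x, V x -> U x) by (intros; now apply Hr).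
  assert (DV : forall x, V x -> is_derive f x (Derive f x)) by auto.
  assert (near_c : forall x, V x -> Rabs (Derive f x - c) < Rabs c / 2)
    by (intros; now apply Hr).
  assert (oV : open V).
  { intros x Hx; assert (0 < r - Rabs (x - a)) as e0 by (unfold V in Hx; lra).
    exists (mkposreal _ e0); intros y Hy; unfold V.
    assert (Rabs (y - x) < r - Rabs (x - a)) by exact Hy.
    pose proof (Rabs_triang (y - x) (x - a)) as T.
    replace (y - x + (x - a)) with (y - a) in T by ring; lra. }
  assert (star : forall x t, V x -> 0 <= t <= 1 -> V (a + t * (x - a))).
  { intros x t Hx Ht; unfold V in *.
    replace (a + t * (x - a) - a) with (t * (x - a)) by ring.
    rewrite Rabs_mult, (Rabs_pos_eq t) by lra.
    pose proof (Rabs_pos (x - a)); nra. }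
  assert (CV' : Ck V N (Derive f)) by now apply (Ck_subset U).
  assert (expand : forall x z, V x -> V z -> Rabs c / 2 * Rabs (x - z) <= Rabs (f x - f z))
    by (intros; now apply (Rabs_diff_lower_bound f a c r)).
  assert (inj : forall x z, V x -> V z -> f x = f z -> x = z).
  { intros x z Vx Vz E; pose proof (expand x z Vx Vz) as K.
    rewrite E, Rminus_diag, Rabs_R0 in K.
    apply Rminus_diag_uniq; destruct (Req_dec (x - z) 0) as [|nz]; [easy|].
    apply Rabs_pos_lt in nz; nra. }
  set (psi := segment_mean a 0 (Derive f)).
  assert (slope : forall x, V x -> f x - b = (x - a) * psi x).
  { rewrite <- hfa; apply (segment_mean_slope V); auto.
    now apply (Ck_continuous V N). }
  assert (psi_a : psi a = c) by apply segment_mean_center.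
  assert (psi_nz : forall x, V x -> psi x <> 0).
  { intros x Vx E; destruct (Req_dec x a) as [->|xa]; [lra|].
    apply xa, inj; auto; rewrite hfa; pose proof (slope x Vx); rewrite E in *; lra. }
  assert (phi_eq : forall x, V x -> phi f a b x = / psi x).
  { intros x Vx; apply phi_inverse_slope; auto; intros ->; easy. }
  assert (Cphi : Ck V N (phi f a b)).
  { apply (Ck_ext V N (fun x => / psi x)); [easy | intros; symmetry; auto |].
    apply Ck_inv; [easy|]; now apply Ck_segment_mean. }
  split; [|exists V; split; [easy|]; split; [easy|]; split; [|now apply Ck_class_C]].
  2:{ intros x Vx xa E; apply xa, inj; auto; lra. }
  (* Half the radius, so that the closed interval on which the intermediate value
     theorem is applied stays inside [V]. *)
  set (d := r / 2); set (e := Rabs c / 2 * d).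
  assert (d0 : 0 < d) by (unfold d; lra).
  assert (e0 : 0 < e) by (apply Rmult_lt_0_compat; lra).
  assert (IV : forall x, oo_interval (a - d) (a + d) x -> V x).
  { unfold oo_interval, V, d; intros; apply Rabs_def1; lra. }
  exists (a - d), (a + d), (b - e), (b + e); intros I J.
  split; [unfold I, oo_interval; lra|]; split; [auto|].
  split; [unfold J, oo_interval; lra|]; split.
  - intros y Jy.
    destruct (preimage_exists f a c r hf'a DV near_c d y) as [x [Ix fx]]; auto.
    + unfold d; lra.
    + rewrite hfa; unfold J, oo_interval in Jy; apply Rabs_def1; fold e; lra.
    + exists x; split; [split; easy|].
      intros z [Iz fz]; apply inj; auto; now rewrite fz.
  - intros g Hg; split.
    + split.
      * intros x [y [Jy <-]]; destruct (Hg y Jy) as [_ ->]; easy.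
      * intros y Jy; split; [exists y; easy | now apply Hg].
    + destruct N as [|M]; [lia|].
      set (w := fun x => f x - b).
      assert (jet : Ck V (S (S M)) (lagrange_remainder a M w (phi f a b)) /\
        forall i, (i < S (S M))%nat -> Derive_n (lagrange_remainder a M w (phi f a b)) i a = 0).
      { apply (lagrange_remainder_jet V a oV Va M w (Derive f)); auto.
        - intros x Vx; unfold w; replace (Derive f x) with (Derive f x - 0) by ring.
          apply (is_derive_minus f (fun _ => b)); [auto | apply @is_derive_const].
        - intros x Vx; unfold w; rewrite slope, phi_eq by easy; field; auto.
        - unfold w; lra. }
      destruct jet as [CE E0].
      destruct (Ck_vanishing_bound V a oV Va _ _ CE E0) as [C [h [C0 HC]]].
      set (k := Rabs c / 2).
      assert (k0 : 0 < k) by (unfold k; lra).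
      (* [|g y - a| <= |y - b| / k]: this turns the bound in [g y - a] into one in
         [y - b], and shows that [g y] is within [h] of [a] when [|y - b| < k * h]. *)
      exists (C * (/ k) ^ S (S M)).
      assert (s0 : 0 < Rmin e (k * h))
        by (apply Rmin_pos; [easy | apply Rmult_lt_0_compat; [easy | apply cond_pos]]).
      exists (mkposreal _ s0); intros y Hy.
      assert (Hy' : Rabs (y - b) < Rmin e (k * h)) by exact Hy.
      pose proof (Rmin_l e (k * h)); pose proof (Rmin_r e (k * h)).
      assert (Jy : J y) by (unfold J, oo_interval; apply Rabs_def2 in Hy'; lra).
      destruct (Hg y Jy) as [Ig fg].
      pose proof (expand (g y) a (IV _ Ig) Va) as K; fold k in K; rewrite fg, hfa in K.
      rewrite <- fg at 2; rewrite lagrange_sum_remainder.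
      apply Rle_trans with (C * Rabs (g y - a) ^ S (S M)).
      * apply HC; apply (Rmult_lt_reg_l k); lra.
      * rewrite Rmult_assoc, <- Rpow_mult_distr.
        apply Rmult_le_compat_l; [easy|]; apply pow_incr; split; [apply Rabs_pos|].
        apply (Rmult_le_reg_l k); [easy|].
        rewrite <- Rmult_assoc, Rinv_r, Rmult_1_l by lra; exact K.
Qed.
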